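(* There is a deterministic data structure (the Learned DFS Ordering) that, given at the start a prediction $\tilde{\alpha}(v)$ for each vertex $v$, solves the incremental topological ordering and cycle detection problem with total running time $O(m\eta+n)$ over all $m$ edge insertions.
   Context: Incremental topological ordering and cycle detection: there is a vertex set $V$ with $|V|=n$ and initially no edges; directed edges $e_1,\dots,e_m$ arrive one at a time, $G_t$ denotes the graph after $t$ insertions. After each insertion, the data structure must report a directed cycle if $G_t$ contains one (and then terminate), and otherwise maintain a labeling $L:V\to\mathbb{Z}$ with $L(x)<L(y)$ for every edge $(x,y)$ of $G_t$. $G_m$ denotes the final graph (after the last insertion not creating a cycle). A vertex $x$ is an ancestor of $y$ if there is a directed path from $x$ to $y$ (every vertex is its own ancestor). An edge $(x,y)$ is an ancestor edge of $w$ if $y$ is an ancestor of $w$. Let $\alpha(v)$ be the number of ancestor edges of $v$ in $G_m$. The prediction error is $\eta=\max_{v\in V}|\tilde{\alpha}(v)-\alpha(v)|$, assumed to be at least $1$. *)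

(* Defs.v *)
From mathcomp Require Import all_boot all_order all_algebra.

Set Implicit Arguments.
Unset Strict Implicit.
Unset Printing Implicit Defensive.

Import GRing.Theory Num.Theory.

(** * Cost model

    A word RAM, presented as a structured imperative language. The memory
    consists of integer registers and integer arrays; a program mentions only
    finitely many of either, so the arrays can be interleaved in one flat
    memory. Every operation costs one unit. *)

Inductive binop := OAdd | OSub | OMul | OLe | OEq.

Inductive expr :=
  | Lit of int
  | Reg of nat
  | Get of nat & expr
  | Bin of binop & expr & expr.

Inductive cmd :=
  | Skip
  | Set_ of nat & expr
  | Put of nat & expr & expr
  | Seq of cmd & cmd
  | If of expr & cmd & cmd
  | While of expr & cmd.

Record state := State { reg : nat -> int; arr : nat -> int -> int }.

Definition set_reg (s : state) (x : nat) (z : int) : state :=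
  State (fun y => if y == x then z else reg s y) (arr s).

Definition set_arr (s : state) (a : nat) (i z : int) : state :=
  State (reg s)
    (fun b j => if (b == a) && (j == i) then z else arr s b j).

Definition binop_val (o : binop) (x y : int) : int :=
  match o with
  | OAdd => (x + y)%R
  | OSub => (x - y)%R
  | OMul => (x * y)%R
  | OLe => Posz (x <= y)%R
  | OEq => Posz (x == y)
  end.

Fixpoint eval (s : state) (e : expr) : int :=
  match e with
  | Lit z => z
  | Reg x => reg s x
  | Get a i => arr s a (eval s i)
  | Bin o e1 e2 => binop_val o (eval s e1) (eval s e2)
  end.

Fixpoint ecost (e : expr) : nat :=
  match e with
  | Lit _ | Reg _ => 1
  | Get _ i => (ecost i).+1
  | Bin _ e1 e2 => (ecost e1 + ecost e2).+1
  end.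

(** [exec W c s k s']: started in [s], the command [c] terminates in [s'] after
    [k] units of time. [W] bounds the words: a write whose value or address
    exceeds [W] in absolute value is stuck. Intermediate values need no check,
    since the expressions of a fixed program yield values polynomial in [W].
    A condition holds when its value is nonzero. *)
Inductive exec (W : nat) : cmd -> state -> nat -> state -> Prop :=
  | exec_skip s : exec W Skip s 1 s
  | exec_set s x e :
      (absz (eval s e) <= W)%N ->
      exec W (Set_ x e) s (ecost e).+1 (set_reg s x (eval s e))
  | exec_put s a i e :
      (absz (eval s i) <= W)%N -> (absz (eval s e) <= W)%N ->
      exec W (Put a i e) s (ecost i + ecost e).+1
        (set_arr s a (eval s i) (eval s e))
  | exec_seq c1 c2 s k1 s1 k2 s2 :
      exec W c1 s k1 s1 -> exec W c2 s1 k2 s2 ->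
      exec W (Seq c1 c2) s (k1 + k2) s2
  | exec_if_true e c1 c2 s k s1 :
      eval s e != 0%R -> exec W c1 s k s1 ->
      exec W (If e c1 c2) s (ecost e + k).+1 s1
  | exec_if_false e c1 c2 s k s1 :
      eval s e = 0%R -> exec W c2 s k s1 ->
      exec W (If e c1 c2) s (ecost e + k).+1 s1
  | exec_while_stop e c s :
      eval s e = 0%R -> exec W (While e c) s (ecost e).+1 s
  | exec_while_step e c s k1 s1 k2 s2 :
      eval s e != 0%R -> exec W c s k1 s1 -> exec W (While e c) s1 k2 s2 ->
      exec W (While e c) s (ecost e + k1 + k2).+1 s2.

Lemma exec_deterministic W c s k1 s1 k2 s2 :
  exec W c s k1 s1 -> exec W c s k2 s2 -> k1 = k2 /\ s1 = s2.
Proof.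
move=> H; move: k2 s2; induction H => k' s' H'; inversion H'; subst => //;
  repeat match goal with
  | E : eval ?s ?e = _, N : is_true (eval ?s ?e != _) |- _ =>
      by rewrite E eqxx in N
  | IH : forall k s, exec _ ?c ?s0 k s -> _, X : exec _ ?c ?s0 _ _ |- _ =>
      have [? ?] := IH _ _ X; clear X; subst
  end; by [].
Qed.

(** * Graphs

    A graph on the vertex set ['I_n] is the sequence of its edges in order of
    insertion; parallel edges and loops are allowed. *)

Definition edge (n : nat) : Type := ('I_n * 'I_n)%type.

Definition arc n (es : seq (edge n)) : rel 'I_n := fun x y => (x, y) \in es.

Definition dicycle n (es : seq (edge n)) (p : seq 'I_n) : Prop :=
  p <> [::] /\ ucycle (arc es) p.

Definition acyclic n (es : seq (edge n)) : Prop :=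
  ~ exists p, dicycle es p.

Definition ancestor n (es : seq (edge n)) (x y : 'I_n) : bool :=
  connect (arc es) x y.

Definition ancestor_edge n (es : seq (edge n)) (w : 'I_n) (e : edge n) : bool :=
  ancestor es e.2 w.

Definition alpha n (es : seq (edge n)) (v : 'I_n) : nat :=
  count (ancestor_edge es v) es.

Definition eta n (pred : 'I_n -> int) (es : seq (edge n)) : nat :=
  \max_(v < n) absz (pred v - Posz (alpha es v))%R.

(** [m] insertions are made before a cycle appears, if one ever does. *)
Definition acyclic_length n (es : seq (edge n)) (m : nat) : Prop :=
  [/\ m <= size es, acyclic (take m es)
    & m < size es -> ~ acyclic (take m.+1 es)].

(** * Incremental topological ordering and cycle detection *)

Record data_structure := DataStructure { ds_init : cmd; ds_insert : cmd }.

Definition reg_n := 0.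
Definition reg_tail := 1.
Definition reg_head := 2.
Definition reg_status := 3.
Definition reg_cycle_size := 4.
Definition arr_pred := 0.
Definition arr_label := 1.
Definition arr_cycle := 2.

Definition start_state n (pred : 'I_n -> int) : state :=
  State (fun x => if x == reg_n then Posz n else 0%R)
    (fun a i =>
       if i is Posz j then
         if a == arr_pred then
           if insub j is Some v then pred v else 0%R
         else 0%R
       else 0%R).

Definition load_edge n (s : state) (e : edge n) : state :=
  set_reg (set_reg s reg_tail (Posz e.1)) reg_head (Posz e.2).

Definition label n (s : state) (v : 'I_n) : int := arr s arr_label (Posz v).

Definition topological_labeling n (es : seq (edge n)) (L : 'I_n -> int) : Prop :=
  forall x y, (x, y) \in es -> (L x < L y)%R.

Definition answers_labeling n (es : seq (edge n)) (s : state) : Prop :=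
  reg s reg_status = 0%R /\ topological_labeling es (label s).

Definition answers_cycle n (es : seq (edge n)) (s : state) : Prop :=
  reg s reg_status = 1%R /\
  exists p : seq 'I_n,
    [/\ dicycle es p, reg s reg_cycle_size = Posz (size p)
      & [seq arr s arr_cycle (Posz j) | j <- iota 0 (size p)]
        = [seq Posz (nat_of_ord x) | x <- p]].

(** [serves D W past s future k]: in state [s], reached after the insertions
    [past], the data structure answers the insertions [future] correctly, in
    total time [k], stopping at the first cycle. A graph has a topological
    labeling only if it is acyclic, so the graph determines which kind of
    answer is given. *)
Inductive serves (D : data_structure) (W n : nat) :
    seq (edge n) -> state -> seq (edge n) -> nat -> Prop :=
  | serves_done past s : serves D W past s [::] 0
  | serves_labeling past s e future k s1 k1 :
      exec W (ds_insert D) (load_edge s e) k s1 ->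
      answers_labeling (rcons past e) s1 ->
      serves D W (rcons past e) s1 future k1 ->
      serves D W past s (e :: future) (k + k1)
  | serves_cycle past s e future k s1 :
      exec W (ds_insert D) (load_edge s e) k s1 ->
      answers_cycle (rcons past e) s1 ->
      serves D W past s (e :: future) k.

Definition solves (D : data_structure) (W n : nat) (pred : 'I_n -> int)
    (es : seq (edge n)) (k : nat) : Prop :=
  exists k0 s0 k1,
    [/\ exec W (ds_init D) (start_state pred) k0 s0,
        serves D W [::] s0 es k1 & k = k0 + k1].

(** Words have [O(log (n + m + max |pred|))] bits when [c] is a constant. *)
Definition word_bound n (pred : 'I_n -> int) (m c : nat) : nat :=
  (n + m + \max_(v < n) absz (pred v)).+2 ^ c.

(* Main.v *)
Require Import Defs.
From mathcomp Require Import all_boot all_order all_algebra.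
From mathcomp Require Import zify.

(** Labels start at the predictions and only decrease, so that [L x < L y] holds
    for every edge [(x, y)]. In an acyclic final graph [alpha] is itself strictly
    increasing along edges; hence so is [B = alpha - eta], and since the
    predictions lie above [B], a label that is lowered only as far as an edge
    forces it to never goes below [B]. So every label drops by at most [2 eta] in
    total. Only tails of edges are lowered, and lowering [x] costs [O(1)] plus
    the in-degree of [x], which sums to [O(m eta)].

    When [(u, v)] arrives with [L v <= L u], a first backward search from [u]
    lowers to [L v - 1] every ancestor of [u] with a larger label, each of them
    once. If it lowers [v], the parent pointers give a cycle; otherwise no cycle
    exists, and a second pass over the same queue restores strictness. The first
    pass alone costs [O(n + m)], which pays for the one insertion that closes a
    cycle, where the bound [B] is not available. *)

Set Implicit Arguments.
Unset Strict Implicit.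
Unset Printing Implicit Defensive.

Import Order.TTheory GRing.Theory Num.Theory.

(** * The data structure as a RAM program *)

Definition reg_size := 5.
Definition reg_done := 6.
Definition reg_y := 7.
Definition reg_new := 8.
Definition reg_i := 9.
Definition reg_x := 10.
Definition reg_z := 11.
Definition reg_low := 12.
Definition arr_adj := 3.
Definition arr_deg := 4.
Definition arr_queue := 5.
Definition arr_parent := 6.

Local Notation add := (Bin OAdd).
Local Notation sub := (Bin OSub).
Local Notation mul := (Bin OMul).
Local Notation le := (Bin OLe).
Local Notation one := (Lit 1%R).
Local Notation incr r := (Set_ r (add (Reg r) one)).
Local Notation "c1 ;; c2" := (Seq c1 c2) (at level 90, right associativity).

(** Strict comparisons [a < b] are written [a + 1 <= b], as the instruction set has no strict one.
    The loop relies on [reg_i] being 0 in the start state. *)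
Definition init_cmd : cmd :=
  While (le (add (Reg reg_i) one) (Reg reg_n))
    (Put arr_label (Reg reg_i) (Get arr_pred (Reg reg_i)) ;; incr reg_i).

Definition scan_cmd : cmd :=
  While (le (add (Reg reg_i) one) (Get arr_deg (Reg reg_y)))
    (Set_ reg_x (Get arr_adj (add (mul (Reg reg_i) (Reg reg_n)) (Reg reg_y))) ;;
     If (le (add (Reg reg_new) one) (Get arr_label (Reg reg_x)))
       (Put arr_label (Reg reg_x) (Reg reg_new) ;;
        Put arr_parent (Reg reg_x) (Reg reg_y) ;;
        Put arr_queue (Reg reg_size) (Reg reg_x) ;;
        incr reg_size)
       Skip ;;
     incr reg_i).

(** Entries are never removed, so the second pass ([d = 1]) rescans what the
    first one ([d = 0]) found. *)
Definition queue_cmd (d : nat) : cmd :=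
  While (le (add (Reg reg_done) one) (Reg reg_size))
    (Set_ reg_y (Get arr_queue (Reg reg_done)) ;;
     Set_ reg_new (sub (Get arr_label (Reg reg_y)) (Lit (Posz d))) ;;
     Set_ reg_i (Lit 0%R) ;;
     scan_cmd ;;
     incr reg_done).

Definition pass_cmd (d : nat) : cmd :=
  Set_ reg_done (Lit 0%R) ;; queue_cmd d.

Definition walk_cmd : cmd :=
  While (sub (Reg reg_z) (Reg reg_tail))
    (Set_ reg_z (Get arr_parent (Reg reg_z)) ;;
     Put arr_cycle (Reg reg_cycle_size) (Reg reg_z) ;;
     incr reg_cycle_size).

(** The cycle starts at the head, follows parents up to the tail, and is closed by the inserted
    edge. *)
Definition report_cmd : cmd :=
  Set_ reg_status one ;;
  Set_ reg_z (Reg reg_head) ;;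
  Put arr_cycle (Lit 0%R) (Reg reg_z) ;;
  Set_ reg_cycle_size one ;;
  walk_cmd.

Definition store_cmd : cmd :=
  Put arr_adj (add (mul (Get arr_deg (Reg reg_head)) (Reg reg_n)) (Reg reg_head))
    (Reg reg_tail) ;;
  Put arr_deg (Reg reg_head) (add (Get arr_deg (Reg reg_head)) one).

(** [reg_low] remembers [L v - 1], since the search may overwrite the label of the head; comparing
    the two afterwards tells whether it did. *)
Definition search_cmd : cmd :=
  Set_ reg_low (sub (Get arr_label (Reg reg_head)) one) ;;
  Put arr_label (Reg reg_tail) (Reg reg_low) ;;
  Put arr_queue (Lit 0%R) (Reg reg_tail) ;;
  Set_ reg_size one ;;
  pass_cmd 0.

Definition insert_cmd : cmd :=
  store_cmd ;;
  If (le (Get arr_label (Reg reg_head)) (Get arr_label (Reg reg_tail)))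
    (search_cmd ;;
     If (le (Get arr_label (Reg reg_head)) (Reg reg_low)) report_cmd (pass_cmd 1))
    Skip.

Definition learned_dfs : data_structure := DataStructure init_cmd insert_cmd.

(** * Total-correctness reasoning that tracks running time *)

Definition wp (W : nat) (c : cmd) (s : state) (Q : nat -> state -> Prop) : Prop :=
  exists k s', exec W c s k s' /\ Q k s'.

Section Wp.
Variable W : nat.
Implicit Types (s : state) (Q : nat -> state -> Prop).

Lemma wp_mono c s Q Q' :
  (forall k s', Q k s' -> Q' k s') -> wp W c s Q -> wp W c s Q'.
Proof. by move=> QQ' [k [s' [E /QQ' H]]]; exists k, s'. Qed.

Lemma wp_skip s Q : Q 1 s -> wp W Skip s Q.
Proof. by move=> H; exists 1, s; split=> //; exact: exec_skip. Qed.

Lemma wp_set x e s Q :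
  absz (eval s e) <= W -> Q (ecost e).+1 (set_reg s x (eval s e)) ->
  wp W (Set_ x e) s Q.
Proof. by move=> le_W H; do 2!eexists; split; [exact: exec_set|]. Qed.

Lemma wp_put a i e s Q :
  absz (eval s i) <= W -> absz (eval s e) <= W ->
  Q (ecost i + ecost e).+1 (set_arr s a (eval s i) (eval s e)) ->
  wp W (Put a i e) s Q.
Proof. by move=> iW eW H; do 2!eexists; split; [exact: exec_put|]. Qed.

Lemma wp_seq c1 c2 s Q :
  wp W c1 s (fun k1 s1 => wp W c2 s1 (fun k2 s2 => Q (k1 + k2) s2)) ->
  wp W (Seq c1 c2) s Q.
Proof.
move=> [k1 [s1 [E1 [k2 [s2 [E2 H]]]]]].
by exists (k1 + k2), s2; split=> //; exact: exec_seq E1 E2.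
Qed.

Lemma wp_if e c1 c2 s Q :
  (eval s e != 0%R -> wp W c1 s (fun k => Q (ecost e + k).+1)) ->
  (eval s e = 0%R -> wp W c2 s (fun k => Q (ecost e + k).+1)) ->
  wp W (If e c1 c2) s Q.
Proof.
move=> H1 H2; have [e0|e0] := eqVneq (eval s e) 0%R.
  by have [k [s' [E H]]] := H2 e0; do 2!eexists; split; [exact: exec_if_false E|].
by have [k [s' [E H]]] := H1 e0; do 2!eexists; split; [exact: exec_if_true E|].
Qed.

Lemma wp_while e c s Q :
  (eval s e = 0%R -> Q (ecost e).+1 s) ->
  (eval s e != 0%R ->
     wp W c s (fun k1 s1 =>
       wp W (While e c) s1 (fun k2 => Q (ecost e + k1 + k2).+1))) ->
  wp W (While e c) s Q.
Proof.
move=> H1 H2; have [e0|e0] := eqVneq (eval s e) 0%R.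
  by do 2!eexists; split; [exact: exec_while_stop|exact: H1].
have [k1 [s1 [E1 [k2 [s2 [E2 H]]]]]] := H2 e0.
by do 2!eexists; split; [exact: exec_while_step E1 E2|].
Qed.

End Wp.

(** * In-neighbour lists and their representation in memory *)

Definition in_nbrs n (es : seq (edge n)) (y : 'I_n) : seq 'I_n :=
  [seq e.1 | e <- es & e.2 == y].

Definition indeg n (es : seq (edge n)) (y : 'I_n) : nat := size (in_nbrs es y).

(** The extra 1 per entry covers the fixed work at a vertex and makes this a bound on the queue
    length as well. *)
Definition scan_cost n (es : seq (edge n)) (q : seq 'I_n) : nat :=
  \sum_(y <- q) (indeg es y).+1.

Definition upd n (T : Type) (f : 'I_n -> T) (x : 'I_n) (z : T) : 'I_n -> T :=
  fun y => if y == x then z else f y.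

(** The [i]-th in-neighbour of [y] is stored at address [i * n + y]. *)
Definition stores n (es : seq (edge n)) (s : state) : Prop :=
  forall y : 'I_n, arr s arr_deg (Posz y) = Posz (indeg es y) /\
    forall i, i < indeg es y ->
      arr s arr_adj (Posz (i * n + y)) = Posz (nth y (in_nbrs es y) i).

Lemma mem_in_nbrs n (es : seq (edge n)) x y : (x \in in_nbrs es y) = ((x, y) \in es).
Proof.
apply/mapP/idP => [[[a b]]|xy].
  by rewrite mem_filter /= => /andP[/eqP-> ?] ->.
by exists (x, y); rewrite // mem_filter eqxx.
Qed.

Lemma indeg_size n (es : seq (edge n)) y : indeg es y <= size es.
Proof. by rewrite /indeg size_map size_filter count_size. Qed.

Lemma scan_cost_size n (es : seq (edge n)) q : size q <= scan_cost es q.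
Proof. by rewrite /scan_cost; elim: q => [|y q IH]; rewrite ?big_cons //=; lia. Qed.

(** The memory during a search. Parents are integers rather than vertices because outside the queue
    the array may hold leftovers of earlier searches. *)
Record view n (u v : 'I_n) (b : int) (es : seq (edge n))
    (L par : 'I_n -> int) (q : seq 'I_n) (s : state) : Prop := View {
  view_n : reg s reg_n = Posz n;
  view_tail : reg s reg_tail = Posz u;
  view_head : reg s reg_head = Posz v;
  view_status : reg s reg_status = 0%R;
  view_low : reg s reg_low = b;
  view_graph : stores es s;
  view_label : forall x : 'I_n, arr s arr_label (Posz x) = L x;
  view_parent : forall x : 'I_n, arr s arr_parent (Posz x) = par x;
  view_size : reg s reg_size = Posz (size q);
  view_queue : forall i, i < size q ->
    arr s arr_queue (Posz i) = Posz (nth u q i) }.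

(** * One search pass, for an abstract invariant that serves both passes *)

Section Pass.
Variables (n : nat) (u v : 'I_n) (b : int) (es : seq (edge n)) (d W N : nat).
Variable Inv : ('I_n -> int) -> ('I_n -> int) -> seq 'I_n -> Prop.
Implicit Types (L par : 'I_n -> int) (q : seq 'I_n) (s : state).

Hypothesis n_le_W : n <= W.
Hypothesis N_lt_W : N < W.
Hypothesis Inv_bound : forall L par q, Inv L par q ->
  scan_cost es q <= N /\ forall x, absz (L x) + d <= W.
Hypothesis Inv_lower : forall L par q x y, Inv L par q ->
  y \in q -> (x, y) \in es -> (L y - Posz d < L x)%R ->
  x != y /\ Inv (upd L x (L y - Posz d)%R) (upd par x (Posz y)) (rcons q x).

(** The worklist invariant: an edge can call for a lowering only while its head awaits scanning, so
    an exhausted queue leaves no such edge. *)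
Definition pending L q h : Prop :=
  forall x y, (x, y) \in es -> (L y - Posz d < L x)%R -> y \in drop h q.

(** Induction on the number [j] of in-neighbours left. A lowered [x] differs from [y], so [L y], and
    with it [reg_new], stays valid throughout the scan. *)
Lemma scan_ok y h j i L par q s :
  indeg es y = i + j -> view u v b es L par q s -> Inv L par q ->
  h < size q -> nth u q h = y -> reg s reg_done = Posz h ->
  reg s reg_y = Posz y -> reg s reg_new = (L y - Posz d)%R ->
  reg s reg_i = Posz i ->
  (forall a, a \in take i (in_nbrs es y) -> (L a <= L y - Posz d)%R) ->
  pending L q h ->
  wp W scan_cmd s (fun k s' => exists L' par' r,
    [/\ view u v b es L' par' (q ++ r) s', Inv L' par' (q ++ r),
        pending L' (q ++ r) h.+1, reg s' reg_done = Posz h & k <= 40 * j + 10]).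
Proof.
elim: j i L par q s => [|j IH] i L par q s dy V I hq qh rh ry rT ri Hdone Hpend.
all: have [Vn Vu Vv Vst Vb Vg VL Vp Vsz Vq] := V.
all: have [gdeg gadj] := Vg y.
(* Four goals: loop exit or entry, with no or some in-neighbours left. The two mixed ones are
   contradictory. *)
all: apply: wp_while => /=; rewrite -/scan_cmd ry ri gdeg dy ?addn0.
- move=> _; exists L, par, [::]; rewrite cats0; split=> //.
  move=> x z xz lt; have := Hpend x z xz lt.
  rewrite (drop_nth u hq) qh inE => /orP[/eqP zy|//]; subst z.
  have xin : x \in in_nbrs es y by rewrite mem_in_nbrs.
  move: (Hdone x); rewrite take_oversize; last by rewrite -/(indeg es y) dy addn0.
  by move=> /(_ xin); lia.
- by move=> H; exfalso; move: H; lia.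
- by move=> H; exfalso; move: H; lia.
move=> _.
have yq : y \in q by rewrite -qh mem_nth.
have [costN LW] := Inv_bound I.
have szq := scan_cost_size es q.
have iy : i < indeg es y by rewrite dy; lia.
pose x := nth y (in_nbrs es y) i.
have xy : (x, y) \in es by rewrite -mem_in_nbrs mem_nth.
have adj : arr s arr_adj (Posz i * Posz n + Posz y)%R = Posz x by rewrite -gadj.
have xn := ltn_ord x; have yn := ltn_ord y.
(* [y] is queued, so [scan_cost] already counts its in-degree; this keeps the counter within a
   word. *)
have iN : i < N.
  apply: leq_trans costN; rewrite /scan_cost (big_rem y) //=; lia.
apply: wp_seq; apply: wp_set; rewrite /= ry ri Vn adj; first by lia.
apply: wp_seq; apply: wp_if => /=; rewrite rT VL => Hc.
- have lt : (L y - Posz d < L x)%R by move: Hc; lia.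
  have [xNy I'] := Inv_lower I yq xy lt.
  have LWy := LW y; have LWx := LW x.
  have [costN' _] := Inv_bound I'; have := scan_cost_size es (rcons q x).
  rewrite size_rcons => szq'.
  apply: wp_seq; apply: wp_put => /=; rewrite ?rT; [lia|lia|].
  apply: wp_seq; apply: wp_put => /=; rewrite ?ry; [lia|lia|].
  apply: wp_seq; apply: wp_put => /=; rewrite ?Vsz; [lia|lia|].
  apply: wp_set => /=; rewrite ?Vsz; first by lia.
  apply: wp_set => /=; rewrite ?ri; first by lia.
  set s1 := set_reg _ _ _.
  have uL a : (upd L x (L y - Posz d)%R a <= L a)%R.
    by rewrite /upd; case: eqP => [->|//]; lia.
  have upy : upd L x (L y - Posz d)%R y = L y.
    by rewrite /upd eq_sym (negPf xNy).
  have := IH i.+1 (upd L x (L y - Posz d)%R) (upd par x (Posz y)) (rcons q x) s1.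
  case=> //; try (by rewrite /s1 /=; lia).
  + split=> //.
    * move=> a; rewrite /s1 /= /upd -VL eqz_nat val_eqE.
      by case: eqP.
    * move=> a; rewrite /s1 /= /upd -Vp eqz_nat val_eqE.
      by case: eqP.
    * by rewrite /s1 /= size_rcons; lia.
    * move=> a; rewrite /s1 /= size_rcons ltnS eqz_nat nth_rcons => le_a.
      by case: (ltngtP a (size q)) le_a => // lt_a _; exact: Vq.
  + by rewrite size_rcons; lia.
  + by rewrite nth_rcons hq.
  + rewrite (take_nth y) // upy => a; rewrite mem_rcons inE => /orP[/eqP->|ain].
      by rewrite /upd eqxx.
    exact: le_trans (uL a) (Hdone a ain).
  (* Lowering [x] can only break edges with head [x], and [x] has just been queued. *)
  + move=> a z az; rewrite -cats1 drop_cat hq mem_cat inE.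
    rewrite {1}/upd; case: eqP => [|_ lt']; first by rewrite orbT.
    apply/orP; left; apply: Hpend az _; exact: lt_le_trans lt' (uL a).
  move=> k [s' [E [L' [par' [r]]]]] [V' I2 P' rd kle].
  exists k, s'; split=> //; exists L', par', (x :: r).
  by rewrite -cat_rcons; split=> //; lia.
apply: wp_skip; apply: wp_set => /=; rewrite ?ri; first by lia.
set s1 := set_reg _ _ _.
have := IH i.+1 L par q s1.
case=> //; try (by rewrite /s1 /=; lia).
  rewrite (take_nth y) // => a; rewrite mem_rcons inE => /orP[/eqP->|ain].
    by move: Hc; rewrite -/x; lia.
  exact: Hdone.
move=> k [s' [E [L' [par' [r]]]]] [V' I2 P' rd kle].
exists k, s'; split=> //; exists L', par', r.
by split=> //; lia.
Qed.

(** A scan costs 40 per in-neighbour plus 10; charging 50 per unit of [scan_cost] also absorbs the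
    rest of the iteration. *)
Lemma queue_ok h L par q s :
  view u v b es L par q s -> Inv L par q -> h <= size q ->
  reg s reg_done = Posz h -> pending L q h ->
  wp W (queue_cmd d) s (fun k s' => exists L' par' r,
    [/\ view u v b es L' par' (q ++ r) s', Inv L' par' (q ++ r),
        forall x y, (x, y) \in es -> (L' x <= L' y - Posz d)%R
      & k <= 50 * scan_cost es (drop h (q ++ r)) + 10]).
Proof.
(* The queue grows while it is processed, but its length never exceeds [N], so this measure
   decreases. *)
have [f] := ubnP (N.+1 - h); elim: f => // f IH in h L par q s *.
move=> ltf V I hq rh Hpend.
have [Vn Vu Vv Vst Vb Vg VL Vp Vsz Vq] := V.
have [costN LW] := Inv_bound I.
have szq := scan_cost_size es q.
apply: wp_while => /=; rewrite -/scan_cmd rh Vsz => Hc.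
  have hsz : h = size q by move: Hc; lia.
  exists L, par, [::]; rewrite cats0; split=> //; [move=> x y xy|lia].
  rewrite leNgt; apply/negP => /(Hpend x y xy).
  by rewrite hsz drop_size.
have {Hc hq} hq : h < size q by move: Hc; lia.
set y := nth u q h; have yn := ltn_ord y; have LWy := LW y.
apply: wp_seq; apply: wp_set => /=; rewrite rh Vq // -/y; first by lia.
apply: wp_seq; apply: wp_set => /=; rewrite VL -/y; first by lia.
apply: wp_seq; apply: wp_set => /=; first by lia.
set s1 := set_reg _ _ _.
apply: wp_seq.
apply: wp_mono (@scan_ok y h (indeg es y) 0 L par q s1 _ _ _ _ _ _ _ _ _ _ _);
  rewrite //=; last by rewrite take0.
move=> k s2 [L2 [par2 [r2 [V2 I2 P2 rd2 kle]]]].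
apply: wp_set => /=; rewrite rd2; first by lia.
apply: wp_mono (IH h.+1 L2 par2 (q ++ r2) _ _ _ _ _ _ _);
  rewrite ?size_cat; try lia; try done.
- move=> k3 s3 [L3 [par3 [r3 []]]]; rewrite -catA => V3 I3 P3 k3le.
  exists L3, par3, (r2 ++ r3); split=> //.
  rewrite (@drop_nth _ u h (q ++ (r2 ++ r3))) ?size_cat; last by lia.
  by rewrite /scan_cost big_cons nth_cat hq -/y -/(scan_cost _ _); lia.
- by case: V2 => *; split.
- by rewrite /=; lia.
Qed.

Lemma pass_ok L par q s :
  view u v b es L par q s -> Inv L par q -> pending L q 0 ->
  wp W (pass_cmd d) s (fun k s' => exists L' par' r,
    [/\ view u v b es L' par' (q ++ r) s', Inv L' par' (q ++ r),
        forall x y, (x, y) \in es -> (L' x <= L' y - Posz d)%R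
      & k <= 50 * scan_cost es (q ++ r) + 12]).
Proof.
move=> V I P; apply: wp_seq; apply: wp_set => //=.
apply: wp_mono (@queue_ok 0 L par q _ _ I _ _ P) => //=; last by case: V => *; split.
move=> k s' [L' [par' [r []]]]; rewrite drop0 => V' I' T' kle.
by exists L', par', r; split=> //; lia.
Qed.

End Pass.

(** * Acyclicity, ancestor edges, degree sums and the potential *)

Lemma acyclic_of_order n (es : seq (edge n)) (r : rel 'I_n) :
  transitive r -> irreflexive r -> (forall x y, (x, y) \in es -> r x y) ->
  acyclic es.
Proof.
move=> tr ir sub_r [[|x p] [//= _ /andP[cyc _]]].
have: path r x (rcons p x) by apply: sub_path cyc => a b; exact: sub_r.
move/(order_path_min tr)/allP/(_ x).
by rewrite mem_rcons mem_head ir => /(_ isT).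
Qed.

Lemma topological_acyclic n (es : seq (edge n)) (L : 'I_n -> int) :
  topological_labeling es L -> acyclic es.
Proof.
move=> topL; apply: (@acyclic_of_order _ _ (fun x y => (L x < L y)%R)) topL.
- by move=> y x z; exact: lt_trans.
- by move=> x; exact: ltxx.
Qed.

Lemma count_lt (T : eqType) (a b : pred T) (s : seq T) x :
  subpred a b -> x \in s -> b x -> ~~ a x -> count a s < count b s.
Proof.
move=> ab xs bx ax.
have := count_predUI a (pred1 x) s.
rewrite (@eq_count _ (predI a _) pred0) ?count_pred0 ?addn0; last first.
  by move=> y /=; case: eqP => [->|_]; rewrite ?(negPf ax) ?andbF.
have : 0 < count_mem x s by rewrite -has_count; apply/hasP; exists x; rewrite /= ?eqxx.
have : count (predU a (pred1 x)) s <= count b s.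
  by apply: sub_count => y /= /orP[/ab|/eqP->].
lia.
Qed.

(** Ancestor edges of [x] are also ancestor edges of [y]. The edge [(x, y)] is one of [y]; were it
    one of [x], a simple path from [y] back to [x] would close a cycle. *)
Lemma alpha_lt n (es : seq (edge n)) x y :
  acyclic es -> (x, y) \in es -> alpha es x < alpha es y.
Proof.
move=> acyc xy; apply: (@count_lt _ _ _ _ (x, y)) (xy) _ _ => [e||].
- by rewrite /ancestor_edge /ancestor => /connect_trans; apply; exact: connect1.
- exact: connect0.
apply/negP => /connectP[p /shortenP[p' py uniq_p _] lastx].
apply: acyc; exists (y :: p'); split=> //; rewrite /ucycle uniq_p andbT /=.
by rewrite rcons_path py /= -lastx.
Qed.

Lemma sum_count (T : eqType) (I : finType) (f : T -> I) (s : seq T) :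
  \sum_x count (fun e => f e == x) s = size s.
Proof.
elim: s => [|e s IH] /=; first by rewrite big1.
rewrite big_split /= IH (bigD1 (f e)) //= eqxx big1 // => x.
by rewrite eq_sym => /negPf->.
Qed.

Lemma indegE n (es : seq (edge n)) y : indeg es y = count (fun e => e.2 == y) es.
Proof. by rewrite /indeg size_map size_filter. Qed.

Lemma scan_cost_uniq n (es : seq (edge n)) q :
  uniq q -> scan_cost es q <= n + size es.
Proof.
move=> uq; rewrite /scan_cost big_uniq //=.
apply: (@leq_trans (\sum_(y : 'I_n) (indeg es y).+1)).
  by rewrite big_mkcond; apply: leq_sum => y _; case: ifP.
under eq_bigr do rewrite -addn1 indegE.
by rewrite big_split /= sum_count sum1_card card_ord addnC.
Qed.

Lemma scan_cost_rcons n (es : seq (edge n)) q x :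
  scan_cost es (rcons q x) = scan_cost es q + (indeg es x).+1.
Proof. by rewrite /scan_cost -cats1 big_cat big_seq1. Qed.

Lemma scan_cost_cat n (es : seq (edge n)) q r :
  scan_cost es (q ++ r) = scan_cost es q + scan_cost es r.
Proof. by rewrite /scan_cost big_cat. Qed.

(** Weighted distance to the floor [B]: once [w x] covers the cost of scanning [x], each unit by
    which a label drops pays for one scan. *)
Definition potential n (w : 'I_n -> nat) (B L : 'I_n -> int) : nat :=
  \sum_x w x * absz (L x - B x)%R.

Lemma potential_le n (w : 'I_n -> nat) (B L L' : 'I_n -> int) :
  (forall x, (B x <= L' x <= L x)%R) -> potential w B L' <= potential w B L.
Proof. by move=> H; apply: leq_sum => x _; rewrite leq_mul2l; have := H x; lia. Qed.

Lemma potential_upd n (w : 'I_n -> nat) (B L : 'I_n -> int) x z :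
  (B x <= z < L x)%R ->
  potential w B (upd L x z) + w x <= potential w B L.
Proof.
move=> Bz; rewrite /potential (bigD1 x) //= [leqRHS](bigD1 x) //=.
rewrite /upd eqxx addnAC leq_add //; first by nia.
by apply: leq_sum => y /negPf->.
Qed.

(** * The state between insertions, the search tree and its parent paths *)

Record idle n (es : seq (edge n)) (L : 'I_n -> int) (s : state) : Prop := Idle {
  idle_n : reg s reg_n = Posz n;
  idle_status : reg s reg_status = 0%R;
  idle_graph : stores es s;
  idle_label : forall x : 'I_n, arr s arr_label (Posz x) = L x }.

(** The invariant of the first pass. Parent edges lie in [es0]: the new edge has tail [u], the root,
    which is never queued again. *)
Record searched n (es0 : seq (edge n)) (L0 : 'I_n -> int) (u : 'I_n) (b : int)
    (L par : 'I_n -> int) (q : seq 'I_n) : Prop := Searched {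
  searched_uniq : uniq q;
  searched_root : u \in q;
  searched_in : forall z, z \in q -> L z = b;
  searched_out : forall z, z \notin q -> L z = L0 z;
  searched_lt : forall z, z \in q -> (b < L0 z)%R;
  searched_parent : forall z, z \in q -> z != u ->
    exists2 y, y \in q & par z = Posz y /\ (z, y) \in es0 }.

(** The original labels [L0] strictly increase along parent edges, so following parents cannot
    repeat a vertex and must end at the root. *)
Lemma parent_path n (es0 : seq (edge n)) L0 u b L par q z :
  topological_labeling es0 L0 -> searched es0 L0 u b L par q -> z \in q ->
  exists p, [/\ path (Defs.arc es0) z p, path (fun x y => par x == Posz y) z p,
                last z p = u & uniq (z :: p)].
Proof.
move=> topL S zq.
suff [p [p1 p2 p3]] : exists p, [/\ path (Defs.arc es0) z p,
    path (fun x y => par x == Posz y) z p & last z p = u].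
  exists p; split=> //.
  have tr : transitive (fun x y => (L0 x < L0 y)%R) by move=> y x t; exact: lt_trans.
  apply: (sorted_uniq tr) => [x|]; first exact: ltxx.
  by apply: sub_path p1 => x y; exact: topL.
(* Induction on the number of vertices whose original label exceeds that of [z]. *)
have [f] := ubnP #|[pred a | (L0 z < L0 a)%R]|.
elim: f => // f IH in z zq * => ltf.
have [->|zu] := eqVneq z u; first by exists [::].
have [y yq [zy /[dup] zy0 /topL ltzy]] := searched_parent S zq zu.
have [|p [p1 p2 p3]] := IH y yq.
  rewrite ltnS in ltf; apply: leq_trans ltf; apply: proper_card; apply/properP; split.
    by apply/subsetP => a; rewrite !inE; exact: lt_trans.
  by exists y; rewrite !inE ?ltxx.
by exists (y :: p); rewrite /= zy eqxx {1}/Defs.arc zy0.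
Qed.

(** Here [c] is the part of the cycle already written and [p] the part to come. The loop stops on
    first meeting [u], which is the end of [p] because the vertices are distinct. *)
Lemma walk_ok n W (u : 'I_n) (par : 'I_n -> int) p z c s :
  n <= W -> size (c ++ p) <= W ->
  path (fun x y => par x == Posz y) z p -> last z p = u -> uniq (z :: p) ->
  reg s reg_z = Posz z -> reg s reg_tail = Posz u ->
  (forall x : 'I_n, arr s arr_parent (Posz x) = par x) ->
  reg s reg_cycle_size = Posz (size c) ->
  (forall j, j < size c -> arr s arr_cycle (Posz j) = Posz (nth u c j)) ->
  wp W walk_cmd s (fun k s' =>
    [/\ reg s' reg_status = reg s reg_status,
        reg s' reg_cycle_size = Posz (size (c ++ p)),
        forall j, j < size (c ++ p) ->
          arr s' arr_cycle (Posz j) = Posz (nth u (c ++ p) j)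
      & k <= 20 * size p + 10]).
Proof.
move=> nW; elim: p => [|a p IH] in z c s *.
  rewrite cats0 /= => cW _ -> _ rz ru Hp rc Hc.
  by apply: wp_while => /=; rewrite rz ru subrr.
move=> cW /= /andP[/eqP za pa] lasta /andP[zp up] rz ru Hp rc Hc.
apply: wp_while => /=; rewrite -/walk_cmd rz ru => Hz.
  exfalso; move: zp; suff -> : z = u by rewrite -lasta mem_last.
  by apply/val_inj; move: Hz; rewrite /=; lia.
have an := ltn_ord a; rewrite size_cat /= in cW.
apply: wp_seq; apply: wp_set => /=; rewrite rz Hp za; first by lia.
apply: wp_seq; apply: wp_put => /=; rewrite ?rc; [lia|lia|].
apply: wp_set => /=; rewrite rc; first by lia.
apply: wp_mono (IH a (rcons c a) _ _ pa lasta up _ _ _ _ _) => //=.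
- move=> k s' [r3 r4 Hc' kle]; rewrite cat_rcons in r4 Hc'.
  by split=> //; move: kle; rewrite /=; lia.
- by rewrite size_cat size_rcons; lia.
- by rewrite size_rcons; lia.
- move=> j; rewrite size_rcons ltnS eqz_nat nth_rcons => le_j.
  by case: (ltngtP j (size c)) le_j => // lt_j _; exact: Hc.
Qed.

(** * One insertion, with and without a cycle *)

Section Insert.
Variables (n W : nat) (es0 : seq (edge n)) (u v : 'I_n) (L0 : 'I_n -> int).
Let es := rcons es0 (u, v).
Hypothesis topL0 : topological_labeling es0 L0.
Hypothesis W_size : n + size es < W.
Hypothesis W_adj : size es * n <= W.
Hypothesis W_label : forall x, absz (L0 x) + 2 <= W.

Lemma in_nbrs_rcons y :
  in_nbrs es y = if v == y then rcons (in_nbrs es0 y) u else in_nbrs es0 y.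
Proof. by rewrite /in_nbrs filter_rcons /=; case: eqP => // _; rewrite map_rcons. Qed.

Lemma store_ok s :
  idle es0 L0 s ->
  wp W store_cmd (load_edge s (u, v)) (fun k s' =>
    [/\ idle es L0 s', reg s' reg_tail = Posz u, reg s' reg_head = Posz v
      & k <= 20]).
Proof.
case=> sn sst sg sL.
have [degv _] := sg v; have un := ltn_ord u; have vn := ltn_ord v.
have ids := indeg_size es0 v.
have szes : size es = (size es0).+1 by rewrite size_rcons.
apply: wp_seq; apply: wp_put => /=; rewrite ?sn ?degv; [nia|lia|].
apply: wp_put => /=; rewrite ?degv; [lia|lia|].
split=> //; split=> // y; have [degy adjy] := sg y; split=> /=.
  rewrite /indeg in_nbrs_rcons eqz_nat val_eqE eq_sym -/(indeg es0 y).
  case: eqP => [<-|_]; last exact: degy.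
  by rewrite size_rcons /indeg; lia.
move=> i; have yn := ltn_ord y.
rewrite -PoszM -PoszD eqz_nat /indeg in_nbrs_rcons.
case: eqP => [vy|vy]; last first.
  move=> lti; rewrite ifF; first exact: adjy.
  (* Residues modulo [n] separate the lists of different heads. *)
  apply/negP => /eqP /(congr1 (modn^~ n)).
  rewrite !modnMDl !modn_small // => yv.
  by apply: vy; apply/val_inj.
rewrite -vy in adjy *; rewrite size_rcons ltnS leq_eqVlt => /orP[/eqP->|lti].
  by rewrite eqxx nth_rcons ltnn eqxx.
rewrite ifF; first by rewrite nth_rcons lti; exact: adjy.
by apply/negP => /eqP; rewrite /indeg; nia.
Qed.

Let b := (L0 v - 1)%R.

Lemma search_ok s :
  (L0 v <= L0 u)%R -> idle es L0 s ->
  reg s reg_tail = Posz u -> reg s reg_head = Posz v ->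
  wp W search_cmd s (fun k s' => exists L par q,
    [/\ view u v b es L par q s', searched es0 L0 u b L par q,
        forall x y, (x, y) \in es -> (L x <= L y)%R
      & k <= 50 * scan_cost es q + 40]).
Proof.
move=> le_vu [sn sst sg sL] su sv.
have un := ltn_ord u; have LWv := W_label v.
apply: wp_seq; apply: wp_set => /=; rewrite sv sL -/b; first by rewrite /b; lia.
apply: wp_seq; apply: wp_put => /=; rewrite ?su; [lia|by rewrite /b; lia|].
apply: wp_seq; apply: wp_put => /=; rewrite ?su; [lia|lia|].
apply: wp_seq; apply: wp_set => /=; first by lia.
set s1 := set_reg _ _ _.
have Hb : absz b <= W by rewrite /b; lia.
apply: wp_mono (@pass_ok n u v b es 0 W (n + size es) (searched es0 L0 u b)
  _ _ _ _ (upd L0 u b) (fun x => arr s arr_parent (Posz x)) [:: u] _ _ _ _).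
- move=> k s' [L [par [r [V S T kle]]]]; exists L, par, ([:: u] ++ r).
  split=> // [x y xy|]; first by have := T x y xy; lia.
  by lia.
- by lia.
- by [].
- move=> L par q S; split; first exact: scan_cost_uniq (searched_uniq S).
  move=> x; have LWx := W_label x.
  have [/(searched_in S)->|/(searched_out S)->] := boolP (x \in q); lia.
- move=> L par q x y S yq; rewrite (searched_in S yq) subr0 => xy lt.
  (* Queued vertices all carry the label [b], so none is lowered twice and the queue stays
     duplicate-free. *)
  have xq : x \notin q by apply/negP => /(searched_in S) H; move: lt; rewrite H ltxx.
  split; first by apply: contraNneq xq => ->.
  have upd_q (T : Type) (f : 'I_n -> T) t z : z \in q -> upd f x t z = f z.
    by move=> zq; rewrite /upd; case: eqP => // zx; rewrite -zx zq in xq.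
  have xu : x != u by apply: contraNneq xq => ->; exact: searched_root S.
  have xy0 : (x, y) \in es0.
    move: xy; rewrite mem_rcons inE => /orP[/eqP[xeu _]|//].
    by rewrite xeu eqxx in xu.
  split.
  + by rewrite rcons_uniq xq (searched_uniq S).
  + by rewrite mem_rcons inE (searched_root S) orbT.
  + move=> z; rewrite mem_rcons inE => /orP[/eqP->|zq]; first by rewrite /upd eqxx.
    by rewrite upd_q // (searched_in S zq).
  + move=> z; rewrite mem_rcons inE negb_or => /andP[/negPf zx zq].
    by rewrite /upd zx (searched_out S zq).
  + move=> z; rewrite mem_rcons inE => /orP[/eqP->|]; last exact: searched_lt S _.
    by rewrite -(searched_out S xq).
  + move=> z; rewrite mem_rcons inE => /orP[/eqP->|zq] zu.
      by exists y; [rewrite mem_rcons inE yq orbT|rewrite /upd eqxx].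
    have [a aq Ha] := searched_parent S zq zu.
    by exists a; [rewrite mem_rcons inE aq orbT|rewrite upd_q].
- split=> //=; rewrite /s1 //=.
  + by move=> x; rewrite /upd eqz_nat val_eqE; case: eqP => // _; exact: sL.
  + by case=> [|i].
- split=> //.
  + by rewrite inE.
  + by move=> z; rewrite inE => /eqP->; rewrite /upd eqxx.
  + by move=> z; rewrite inE => /negPf zu; rewrite /upd zu.
  + by move=> z; rewrite inE => /eqP->; rewrite /b; lia.
  + by move=> z; rewrite inE => /eqP->; rewrite eqxx.
(* Only [u] has been lowered so far, so no edge with head other than [u] calls for a lowering. *)
- move=> x y; rewrite drop0 inE mem_rcons inE /upd.
  case: (eqVneq y u) => // yu /orP[/eqP[-> ->]|/topL0 lt0]; first by rewrite eqxx /b; lia.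
  by case: ifP => [/eqP xu|_]; move: lt0; rewrite ?xu /b; lia.
Qed.

Lemma insert_cyclic s :
  ~ acyclic es -> idle es0 L0 s ->
  wp W insert_cmd (load_edge s (u, v)) (fun k s' =>
    answers_cycle es s' /\ k <= 200 * (n + size es)).
Proof.
move=> cyc I; apply: wp_seq; apply: wp_mono (store_ok I).
move=> k s1 [I1 su sv kle].
have [sn sst sg sL] := I1.
have vn := ltn_ord v.
apply: wp_if => /=; rewrite su sv !sL => Hc; last first.
  exfalso; apply: cyc; apply: (@topological_acyclic _ _ L0) => x y.
  rewrite mem_rcons inE => /orP[/eqP[-> ->]|/topL0 //].
  by move: Hc; lia.
have {Hc} le_vu : (L0 v <= L0 u)%R by move: Hc; lia.
apply: wp_seq; apply: wp_mono (search_ok le_vu I1 su sv).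
move=> k2 s2 [L [par [q [V S T k2le]]]].
have [Vn Vu Vv Vst Vb Vg VL Vp Vsz Vq] := V.
have qcost := scan_cost_uniq es (searched_uniq S).
have vq : v \in q.
  apply/negPn/negP => vq; apply: cyc.
  (* The first pass leaves [L] weakly increasing along edges and strictly so
     along [(u, v)], so ordering by [L], then by [L0], excludes cycles. *)
  pose r x y := (L x < L y)%R || (L x <= L y)%R && (L0 x < L0 y)%R.
  apply: (@acyclic_of_order _ _ r) => [y x z|x|x y xy]; rewrite /r.
  - by lia.
  - by lia.
  have := T x y xy; move: xy; rewrite mem_rcons inE => /orP[/eqP[-> ->]|/topL0 -> ->].
    by rewrite (searched_in S (searched_root S)) (searched_out S vq) /b; lia.
  by rewrite orbT.
apply: wp_if => /=; rewrite Vv VL Vb (searched_in S vq) lexx // => _.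
(* This simple path from [v] to [u], closed by the new edge [(u, v)], is the reported cycle. *)
have [p [p1 p2 p3 p4]] := parent_path topL0 S vq.
have szp : size (v :: p) <= n.
  by rewrite -(card_uniqP p4) -[leqRHS]card_ord max_card.
apply: wp_seq; apply: wp_set => //=; first by lia.
apply: wp_seq; apply: wp_set => /=; rewrite Vv; first by lia.
apply: wp_seq; apply: wp_put => /=; [lia|lia|].
apply: wp_seq; apply: wp_set => //=; first by lia.
apply: wp_mono (@walk_ok n W u par p v [:: v] _ _ _ p2 p3 p4 _ _ _ _ _) => //=.
- move=> k3 s3 [r3 r4 Hc k3le]; split; last first.
    have : 0 < size es by rewrite size_rcons.
    by move: szp; rewrite /=; lia.
  split=> //; exists (v :: p); split=> //.
  + split=> //; rewrite /ucycle p4 andbT /= rcons_path p3.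
    rewrite [X in _ && X]/Defs.arc mem_rcons mem_head andbT.
    by apply: sub_path p1 => x y; rewrite /Defs.arc mem_rcons inE => ->; rewrite orbT.
  + apply: (@eq_from_nth _ 0%R); first by rewrite !size_map size_iota.
    move=> j; rewrite size_map size_iota => ltj.
    by rewrite (nth_map 0) ?size_iota // nth_iota // (nth_map u) // -Hc.
- by lia.
- by move: szp; rewrite /=; lia.
- by case.
Qed.

Variables (B : 'I_n -> int) (w : 'I_n -> nat).
Hypothesis topB : topological_labeling es B.
Hypothesis B_le : forall x, (B x <= L0 x)%R.
Hypothesis W_B : forall x, absz (B x) + 2 <= W.
Hypothesis W_potential : potential w B L0 < W.
Hypothesis w_ge : forall x y, (x, y) \in es -> indeg es x < w x.

(** A queued vertex has dropped by at least 1 and is the tail of some edge, so its weight covers its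
    scan. *)
Lemma searched_potential L par q :
  searched es0 L0 u b L par q -> (forall x, (B x <= L x)%R) ->
  scan_cost es q + potential w B L <= potential w B L0.
Proof.
move=> S BL; rewrite /scan_cost /potential big_uniq ?(searched_uniq S) //=.
rewrite big_mkcond -big_split; apply: leq_sum => x _ /=; have BLx := BL x.
case: ifP => [xq|/negbT xq]; last by rewrite (searched_out S xq).
have lt := searched_lt S xq; have wx : indeg es x < w x.
  have [->|xu] := eqVneq x u; first by apply: (@w_ge _ v); rewrite mem_rcons mem_head.
  have [y _ [_ xy]] := searched_parent S xq xu.
  by apply: (@w_ge _ y); rewrite mem_rcons inE xy orbT.
rewrite (searched_in S xq) in BLx *.
have : (absz (b - B x)%R).+1 <= absz (L0 x - B x)%R by lia.
by nia.
Qed.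

Lemma insert_acyclic s :
  idle es0 L0 s ->
  wp W insert_cmd (load_edge s (u, v)) (fun k s' => exists L,
    [/\ idle es L s', topological_labeling es L,
        forall x, (B x <= L x <= L0 x)%R
      & k + 100 * potential w B L <= 100 * potential w B L0 + 200]).
Proof.
move=> I; apply: wp_seq; apply: wp_mono (store_ok I).
move=> k s1 [I1 su sv kle].
have [sn sst sg sL] := I1.
apply: wp_if => /=; rewrite su sv !sL => Hc; last first.
  apply: wp_skip; exists L0; split=> //; last by lia.
    move=> x y; rewrite mem_rcons inE => /orP[/eqP[-> ->]|/topL0 //].
    by move: Hc; lia.
  by move=> x; rewrite B_le lexx.
have {Hc} le_vu : (L0 v <= L0 u)%R by move: Hc; lia.
apply: wp_seq; apply: wp_mono (search_ok le_vu I1 su sv).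
move=> k2 s2 [L [par [q [V S T k2le]]]].
have [Vn Vu Vv Vst Vb Vg VL Vp Vsz Vq] := V.
(* Queued vertices reach [u], so [B] there is at most [B u < B v]. This keeps [v] out of the queue
   and puts [b = L0 v - 1] above the floor. *)
have Bq z : z \in q -> (B z <= B u)%R.
  move=> zq; have [p [p1 _ <- _]] := parent_path topL0 S zq.
  elim: p z p1 {zq} => //= y p IH z /andP[zy /IH]; apply: le_trans.
  by apply/ltW/topB; rewrite mem_rcons inE -[_ \in es0]/(Defs.arc es0 z y) zy orbT.
have Buv : (B u < B v)%R by apply: topB; rewrite mem_rcons mem_head.
have vq : v \notin q by apply/negP => /Bq; lia.
have BL x : (B x <= L x <= L0 x)%R.
  have [xq|xq] := boolP (x \in q); last by rewrite (searched_out S xq) B_le lexx.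
  have := searched_lt S xq; rewrite (searched_in S xq).
  by have := Bq x xq; have := B_le v; rewrite /b; lia.
apply: wp_if => /=; rewrite Vv VL Vb (searched_out S vq) => Hc.
  by move: Hc; rewrite /b; lia.
(* The second pass extends the queue of the first, so the scan cost of the final queue bounds both
   passes at 50 each: hence the factor 100. Vertices may now recur, and the potential alone limits
   the length. *)
pose Inv (L' par' : 'I_n -> int) q' :=
  (forall x, (B x <= L' x <= L0 x)%R) /\
  scan_cost es q' + potential w B L' <= potential w B L0.
apply: wp_mono (@pass_ok n u v b es 1 W (potential w B L0) Inv
  _ _ _ _ L par q s2 V _ _).
- move=> k3 s3 [L' [par' [r [[W1 W2 W3 W4 W5 W6 W7 _ _ _] [BL' pot] T' k3le]]]].
  exists L'; split=> //.
    by move=> x y xy; have := T' x y xy; lia.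
  by move: pot k3le; rewrite scan_cost_cat; lia.
- by lia.
- by [].
- move=> L' par' q' [BL' pot]; split; first by lia.
  by move=> x; have := BL' x; have := W_B x; have := W_label x; lia.
- move=> L' par' q' x y [BL' pot] yq xy lt.
  have Bxy := topB xy.
  split; first by apply: contraTneq Bxy => ->; rewrite ltxx.
  split.
    move=> z; rewrite /upd; case: eqP => // ->.
    by have := BL' x; have := BL' y; lia.
  have := w_ge xy; rewrite scan_cost_rcons.
  have := @potential_upd _ w B L' x (L' y - Posz 1)%R; rewrite lt andbT.
  by have := BL' y; lia.
- split=> //; apply: searched_potential S _ => x.
  by have /andP[] := BL x.
(* Edges with head outside [q] are strict: old ones since that head kept its label, the new one
   since [L u = b]. *)
- move=> x y xy lt; rewrite drop0.
  apply: contraLR lt => yq; rewrite -leNgt.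
  move: xy; rewrite mem_rcons inE => /orP[/eqP[-> ->]|/topL0 lt0].
    by rewrite (searched_in S (searched_root S)) (searched_out S vq).
  by rewrite (searched_out S yq); have /andP[_] := BL x; lia.
Qed.

End Insert.

(** * Initialisation and the whole run *)

Lemma init_ok n W (pred : 'I_n -> int) :
  n <= W -> (forall x, absz (pred x) <= W) ->
  wp W init_cmd (start_state pred) (fun k s =>
    idle [::] pred s /\ k <= 20 * n + 10).
Proof.
move=> nW predW.
suff loop j i s : i + j = n -> reg s reg_n = Posz n -> reg s reg_status = 0%R ->
    reg s reg_i = Posz i ->
    (forall x : 'I_n, arr s arr_pred (Posz x) = pred x) ->
    (forall x : 'I_n, arr s arr_deg (Posz x) = 0%R) ->
    (forall x : 'I_n, x < i -> arr s arr_label (Posz x) = pred x) ->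
    wp W init_cmd s (fun k s' => idle [::] pred s' /\ k <= 20 * j + 10).
  by apply: (@loop n 0) => //= x; rewrite valK.
elim: j i s => [|j IH] i s ijn sn sst si sp sd sL.
  apply: wp_while => /=; rewrite si sn; last by lia.
  move=> _; split=> //; split=> // x; last by apply: sL; have := ltn_ord x; lia.
apply: wp_while => /=; rewrite -/init_cmd si sn; first by lia.
have ltin : i < n by lia.
pose x := Ordinal ltin; have six : arr s arr_pred (Posz i) = pred x by rewrite -sp.
have := predW x => predWx _.
apply: wp_seq; apply: wp_put => /=; rewrite si ?six; [lia|lia|].
apply: wp_set => /=; rewrite si; first by lia.
apply: wp_mono (IH i.+1 _ _ _ _ _ _ _ _) => //=; try lia.
  by move=> k s' [Is kle]; split=> //; lia.
move=> z; rewrite ltnS leq_eqVlt eqz_nat => /orP[/eqP zi|ltz].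
  by rewrite zi eqxx; congr pred; exact/val_inj.
by rewrite ifF ?sL //; apply/negbTE; lia.
Qed.

Section Serve.
Variables (n W : nat) (es1 rest : seq (edge n)) (pred : 'I_n -> int) (h : nat).
Let m := size es1.
Let B x := (Posz (alpha es1 x) - Posz h)%R.
(** Only tails are lowered, so the out-degree supplies the extra 1 of a scan. Using in-degree plus
    one would sum to [m + n] and bring in a term [n * h]. *)
Let w x := count (fun e => e.1 == x) es1 + count (fun e => e.2 == x) es1.
Hypothesis acyc : acyclic es1.
Hypothesis cyc_next : forall e fut, rest = e :: fut -> ~ acyclic (rcons es1 e).
Hypothesis pred_near : forall x, absz (pred x - Posz (alpha es1 x))%R <= h.
(** The weights sum to [2 * m], and predictions exceed [B] by at most [2 * h]. *)
Lemma potential_pred : potential w B pred <= 4 * (m * h).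
Proof.
apply: (@leq_trans (\sum_x w x * (2 * h))).
  by apply: leq_sum => x _; rewrite leq_mul2l; have := pred_near x; rewrite /B; lia.
rewrite -big_distrl big_split /= !sum_count -/m; lia.
Qed.

Hypothesis W_size : n + m.+1 < W.
Hypothesis W_adj : m.+1 * n <= W.
Hypothesis W_label : forall x, absz (pred x) + 2 * h + 2 <= W.
Hypothesis W_potential : 4 * (m * h) < W.

(** Induction on the remaining insertions: the potential telescopes, leaving 200 per insertion, and
    the last summand pays for the one that may close a cycle. *)
Lemma serve_ok past fut L s :
  past ++ fut = es1 -> idle past L s -> topological_labeling past L ->
  (forall x, (B x <= L x <= pred x)%R) ->
  exists k, serves learned_dfs W past s (fut ++ rest) k /\
    k <= 200 * size fut + 100 * potential w B L + 200 * (n + m.+1).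
Proof.
have W_le L' x : (forall x, (B x <= L' x <= pred x)%R) -> absz (L' x) + 2 <= W.
  move=> BL; have := BL x; have := W_label x; have := pred_near x.
  by rewrite /B; lia.
elim: fut past L s => [|[u v] fut IH] past L s.
  rewrite cats0 => -> I topL BL /=.
  case def_rest: rest => [|[u v] fut]; first by exists 0; split=> //; exact: serves_done.
  have := @insert_cyclic n W es1 u v L topL.
  rewrite size_rcons -/m => /(_ W_size W_adj (fun x => W_le L x BL) s (cyc_next def_rest) I).
  move=> [k [s' [E [ans kle]]]]; exists k; split; first exact: (@serves_cycle learned_dfs) E ans.
  lia.
move=> def_es1 I topL BL.
have sz : size past + (size fut).+1 = m by rewrite /m -def_es1 size_cat.
have sub x y : (x, y) \in rcons past (u, v) -> (x, y) \in es1.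
  rewrite -def_es1 mem_rcons mem_cat !inE.
  by case/orP => ->; rewrite ?orbT.
have := @insert_acyclic n W past u v L topL.
rewrite size_rcons => /(_ _ _ _ B w) insert.
have [||||||||k [s' [E [L' [I' topL' BL' pot]]]]] := insert _ _ _ _ _ _ _ _ s I.
- lia.
- by apply: leq_trans W_adj; rewrite leq_mul2r; lia.
- by move=> x; exact: W_le.
- by move=> x y /sub xy; rewrite /B; have := alpha_lt acyc xy; lia.
- by move=> x; have /andP[] := BL x.
- by move=> x; have := W_label x; have := pred_near x; rewrite /B; lia.
- apply: leq_ltn_trans W_potential; apply: leq_trans potential_pred.
  exact: potential_le.
- move=> x y /sub xy; rewrite indegE /w.
  have : 0 < count (fun e => e.1 == x) es1.
    by rewrite -has_count; apply/hasP; exists (x, y).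
  have -> : es1 = rcons past (u, v) ++ fut by rewrite cat_rcons.
  by rewrite !count_cat; lia.
have BLpred x : (B x <= L' x <= pred x)%R.
  by have := BL x; have := BL' x; lia.
have [|k1 [S1 k1le]] := IH (rcons past (u, v)) L' s' _ I' topL' BLpred.
  by rewrite cat_rcons.
exists (k + k1); split; last by rewrite /=; lia.
case: I' => _ sst _ sL; apply: (@serves_labeling learned_dfs) E _ S1.
by split=> // x y xy; rewrite /label !sL; exact: topL'.
Qed.

End Serve.

Theorem theorem3p5 :
  exists (D : data_structure) (C c : nat),
    forall (n : nat) (pred : 'I_n -> int) (es : seq (edge n)) (m : nat),
      acyclic_length es m ->
      1 <= eta pred (take m es) ->
      exists k : nat,
        solves D (word_bound pred m c) pred es k /\
        k <= C * (m * eta pred (take m es) + n).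
Proof.
(* With [m <= m * h], the potential contributes 400, the insertions 200 and the closing one 200.
   Addresses and potential are quadratic in [M]; the three spare factors of [M ^ 5] absorb constants
   up to 8. *)
exists learned_dfs, 800, 5 => n pred es m [le_m acyc cyc].
set h := eta _ _ => h_gt0.
(* Without vertices the error would be 0. A positive [n] absorbs the additive constants. *)
have n_gt0 : 0 < n.
  by case: n => [|//] in pred es le_m acyc cyc h h_gt0 *; rewrite /h /eta big_ord0 in h_gt0.
set W := word_bound _ _ _.
pose A := \max_(v < n) absz (pred v).
have predA x : absz (pred x) <= A by exact: (leq_bigmax x).
have size1 : size (take m es) = m by exact: size_takel.
have near x : absz (pred x - Posz (alpha (take m es) x))%R <= h.
  exact: (leq_bigmax (F := fun x => absz (pred x - Posz (alpha (take m es) x))%R) x).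
(* [alpha] is at most [m], so the word bound controls the error as well. *)
have hA : h <= A + m.
  apply/bigmax_leqP => x _; have := predA x.
  by have := count_size (ancestor_edge (take m es) x) (take m es); rewrite size1 -/(alpha _ _); lia.
have [M [defM MW MM]] : exists M,
    [/\ n + m + A + 2 <= M, 8 * (M * M) <= W & 2 * M <= M * M].
  exists (n + m + A).+2; split; [lia| |by rewrite leq_mul2r].
  rewrite /W /word_bound -/A; set M := (n + m + A).+2.
  have -> : M ^ 5 = M * M * M * (M * M) by rewrite !expnS expn0 muln1 !mulnA.
  rewrite leq_mul2r; apply/orP; right.
  by apply: (@leq_trans (2 * 2 * 2)); rewrite // !leq_mul.
have mn_le : m.+1 * n <= M * M by rewrite leq_mul //; lia.
have mh_le : m * h <= M * M by rewrite leq_mul //; lia.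
have [k0 [s0 [E0 [I0 k0le]]]] : wp W init_cmd (start_state pred) (fun k s =>
    idle [::] pred s /\ k <= 20 * n + 10).
  by apply: init_ok => [|x]; [|have := predA x]; lia.
have [|||||||k1 [S1 k1le]] :=
  @serve_ok n W (take m es) (drop m es) pred h acyc _ near _ _ _ _ [::] (take m es) pred s0
    erefl I0.
- move=> e fut def_rest; have ltm : m < size es.
    by rewrite ltnNge; apply/negP => /drop_oversize; rewrite def_rest.
  have := cyc ltm; rewrite (take_nth e) //.
  by have := drop_nth e ltm; rewrite def_rest => -[<-].
- by rewrite size1; lia.
- by rewrite size1; lia.
- by move=> x; have := predA x; lia.
- by rewrite size1; lia.
- by [].
- by move=> x; have := near x; lia.
exists (k0 + k1); rewrite cat_take_drop in S1; split; first by exists k0, s0, k1.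
have := potential_pred near; rewrite size1 in k1le * => pot.
have : m <= m * h by rewrite leq_pmulr.
lia.
Qed.
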